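(* The mapping $R\mapsto\varTheta(R)$, defined on finite unital rings, extends to a functor $\varTheta:\mathbf{FinRing}\to\mathbf{Digraph}$.
   Context: $\mathbf{FinRing}$ is the category of finite unital rings and unital ring homomorphisms. $\mathbf{Digraph}$ is the category of directed graphs (loops allowed, at most one edge from $u$ to $v$ for each ordered pair $(u,v)$) and graph homomorphisms (maps on vertices sending edges to edges). For a finite unital ring $R$, define $a\sim b$ if and only if $a=bu=vb$ for some units $u,v\in R$; this is an equivalence relation, and $[a]$ denotes the class of $a$. $\varTheta(R)$ is the directed graph whose vertices are the classes $[a]$, $a\in R$, with a directed edge $[x]\to[y]$ ($[x]$, $[y]$ not necessarily distinct) if and only if $xy=0$ (this is well defined). The functor denoted $\varTheta$ acts on a unital ring homomorphism $f:R\to S$ by $\varTheta(f)([x])=[f(x)]$. *)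

(* Defs.v *)
From HB Require Import structures.
From mathcomp Require Import all_boot all_algebra.
From mathcomp Require Import boolp.

Set Implicit Arguments.
Unset Strict Implicit.
Unset Printing Implicit Defensive.

Import GRing.Theory.
Local Open Scope ring_scope.
Local Open Scope quotient_scope.

Record category := Category {
  ob : Type;
  hom : ob -> ob -> Type;
  idm : forall X, hom X X;
  compm : forall X Y Z, hom Y Z -> hom X Y -> hom X Z;
  compm_idl : forall X Y (f : hom X Y), compm (idm Y) f = f;
  compm_idr : forall X Y (f : hom X Y), compm f (idm X) = f;
  compmA : forall X Y Z W (h : hom Z W) (g : hom Y Z) (f : hom X Y),
    compm h (compm g f) = compm (compm h g) f
}.

(* The functors from C to D whose object map is the given F0; an inhabitant is
   thus an extension of F0 to a functor. *)
Record functor_on (C D : category) (F0 : ob C -> ob D) := FunctorOn {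
  fmap : forall X Y, hom X Y -> hom (F0 X) (F0 Y);
  fmap_id : forall X, fmap (idm X) = idm (F0 X);
  fmap_comp : forall X Y Z (g : hom Y Z) (f : hom X Y),
    fmap (compm g f) = compm (fmap g) (fmap f)
}.
Arguments functor_on : clear implicits.

Lemma rmorphism_ext (R S : pzRingType) (f g : {rmorphism R -> S}) :
  f =1 g -> f = g.
Proof.
move=> /funext; case: f g => [f [[f1] [f2]]] [g [[g1] [g2]]] /= fg.
case: _ / fg g1 g2 => g1 g2.
by rewrite (Prop_irrelevance f1 g1) (Prop_irrelevance f2 g2).
Qed.

Definition ring_id (R : finPzRingType) : {rmorphism R -> R} := idfun.

Definition ring_comp (R S T : finPzRingType) (g : {rmorphism S -> T})
  (f : {rmorphism R -> S}) : {rmorphism R -> T} := g \o f.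

(* finPzRingType includes the zero ring. *)
Definition FinRing : category.
Proof.
by refine (@Category finPzRingType (fun R S => {rmorphism R -> S})
    ring_id ring_comp _ _ _) => *; apply: rmorphism_ext.
Defined.

(* As the edges form a relation, there is at most one edge from u to v. *)
Record digraph := DigraphOf {
  vertex :> Type;
  edge : vertex -> vertex -> Prop
}.

Record digraph_hom (G H : digraph) := DigraphHom {
  vmap :> G -> H;
  vmap_edge : forall u v, edge u v -> edge (vmap u) (vmap v)
}.

Lemma digraph_hom_ext (G H : digraph) (f g : digraph_hom G H) :
  f =1 g -> f = g.
Proof.
move=> /funext; case: f g => [f f1] [g g1] /= fg.
by case: _ / fg g1 => g1; rewrite (Prop_irrelevance f1 g1).
Qed.

Definition digraph_id (G : digraph) : digraph_hom G G :=
  @DigraphHom G G id (fun u v e => e).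

Definition digraph_comp (G H K : digraph) (g : digraph_hom H K)
  (f : digraph_hom G H) : digraph_hom G K :=
  @DigraphHom G K (g \o f) (fun u v e => vmap_edge g (vmap_edge f e)).

Definition Digraph : category.
Proof.
by refine (@Category digraph digraph_hom digraph_id digraph_comp _ _ _)
  => *; apply: digraph_hom_ext.
Defined.

Section Theta.
Variable R : finPzRingType.
Implicit Types a b c u v w x y : R.

(* GRing.unit is not available on finPzRingType. *)
Definition is_unit u := [exists w, (w * u == 1) && (u * w == 1)].

Definition sim a b :=
  [exists u, [exists v,
     [&& is_unit u, is_unit v, a == b * u & a == v * b]]].

Lemma simP a b :
  reflect (exists u v, [/\ is_unit u, is_unit v, a = b * u & a = v * b])
          (sim a b).
Proof.
apply: (iffP existsP) => [[u /existsP[v /and4P[? ? /eqP ? /eqP ?]]]|].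
  by exists u, v.
move=> [u [v [? ? abu avb]]]; exists u; apply/existsP; exists v.
by rewrite -abu -avb !eqxx; apply/and4P.
Qed.

Lemma is_unit1 : is_unit 1.
Proof. by apply/existsP; exists 1; rewrite mulr1 eqxx. Qed.

Lemma is_unitM u v : is_unit u -> is_unit v -> is_unit (u * v).
Proof.
move=> /existsP[u' /andP[/eqP u'u /eqP uu']].
move=> /existsP[v' /andP[/eqP v'v /eqP vv']].
apply/existsP; exists (v' * u').
by rewrite !mulrA -(mulrA v') u'u -(mulrA u) vv' !mulr1 v'v uu' eqxx.
Qed.

Lemma sim_refl : reflexive sim.
Proof.
by move=> a; apply/simP; exists 1, 1; rewrite mul1r mulr1 is_unit1.
Qed.

Lemma sim_sym : symmetric sim.
Proof.
suff imp a b : sim a b -> sim b a by move=> a b; apply/idP/idP; apply: imp.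
move=> /simP[u [v [/existsP[u' u'P] /existsP[v' v'P] abu avb]]].
case/andP: (u'P) => /eqP u'u /eqP uu'; case/andP: (v'P) => /eqP v'v /eqP vv'.
apply/simP; exists u', v'; split.
- by apply/existsP; exists u; rewrite andbC.
- by apply/existsP; exists v; rewrite andbC.
- by rewrite abu -mulrA uu' mulr1.
- by rewrite avb mulrA v'v mul1r.
Qed.

Lemma sim_trans : transitive sim.
Proof.
move=> b a c /simP[u [v [uU vU abu avb]]] /simP[u' [v' [u'U v'U bcu bvc]]].
apply/simP; exists (u' * u), (v * v'); split; try exact: is_unitM.
- by rewrite mulrA -bcu.
- by rewrite -mulrA -bvc.
Qed.

Canonical sim_equiv := EquivRel sim sim_refl sim_sym sim_trans.

Definition simclass := {eq_quot sim}.

Definition cls x : simclass := \pi_simclass x.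

Lemma cls_eqP x y : cls x = cls y <-> sim x y.
Proof. by split=> [/eqmodP|H]; [|apply/eqmodP]. Qed.

Definition Theta : digraph :=
  @DigraphOf simclass
    (fun A B => exists x y, [/\ A = cls x, B = cls y & x * y = 0]).

(* The edges do not depend on the choice of representatives. *)
Lemma Theta_edgeE x y : @edge Theta (cls x) (cls y) <-> x * y = 0.
Proof.
split=> [[x' [y' [/cls_eqP /simP[_ [v [_ _ _ ->]]] ]]]|xy0]; last by exists x, y.
move=> /cls_eqP /simP[u [_ [_ _ -> _]]] xy0.
by rewrite -mulrA (mulrA x') xy0 mul0r mulr0.
Qed.

End Theta.

(* Main.v *)
Require Import Defs.
From mathcomp Require Import all_boot all_algebra.

Set Implicit Arguments.
Unset Strict Implicit.
Unset Printing Implicit Defensive.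

Import GRing.Theory.
Local Open Scope ring_scope.
Local Open Scope quotient_scope.

(** A unital homomorphism preserves units, so it carries [a = b * u = v * b] to a relation of the
    same form ([sim_rmorph]), and [[x] -> [f x]] is well defined ([Theta_map_cls]). Since it also
    preserves products and zero, it maps edges to edges. Identities and composites are then compared
    class by class. *)

Lemma is_unit_rmorph (R S : finPzRingType) (f : {rmorphism R -> S}) (u : R) :
  is_unit u -> is_unit (f u).
Proof.
move=> /existsP[w /andP[/eqP wu /eqP uw]]; apply/existsP; exists (f w).
by rewrite -!rmorphM wu uw rmorph1 eqxx.
Qed.

Lemma sim_rmorph (R S : finPzRingType) (f : {rmorphism R -> S}) (a b : R) :
  sim a b -> sim (f a) (f b).
Proof.
move=> /simP[u [v [uU vU abu avb]]]; apply/simP; exists (f u), (f v).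
by split; rewrite -?rmorphM -?abu -?avb //; apply: is_unit_rmorph.
Qed.

Lemma cls_repr (R : finPzRingType) (A : simclass R) : cls (repr A) = A.
Proof. exact: reprK. Qed.

(** [f] is applied to a chosen representative, which makes the map total at once; independence of
    the choice is [Theta_map_cls]. *)
Definition Theta_map (R S : finPzRingType) (f : {rmorphism R -> S})
  (A : Theta R) : Theta S := cls (f (repr (A : simclass R))).

Lemma Theta_map_cls (R S : finPzRingType) (f : {rmorphism R -> S}) (x : R) :
  Theta_map f (cls x) = cls (f x).
Proof. by apply/cls_eqP/sim_rmorph/cls_eqP; rewrite cls_repr. Qed.

Lemma Theta_map_edge (R S : finPzRingType) (f : {rmorphism R -> S})
  (A B : Theta R) : edge A B -> edge (Theta_map f A) (Theta_map f B).
Proof.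
(* The edge supplies its own representatives with [x * y = 0], so the chosen ones can be
   discarded. *)
move=> [x [y [-> -> xy0]]]; rewrite !Theta_map_cls.
by apply/Theta_edgeE; rewrite -rmorphM xy0 rmorph0.
Qed.

Definition Theta_hom (R S : finPzRingType) (f : {rmorphism R -> S}) :
  digraph_hom (Theta R) (Theta S) := DigraphHom (@Theta_map_edge R S f).

Lemma Theta_hom_id (R : finPzRingType) :
  Theta_hom (ring_id R) = digraph_id (Theta R).
Proof. by apply: digraph_hom_ext => A; apply: cls_repr. Qed.

Lemma Theta_hom_comp (R S T : finPzRingType) (g : {rmorphism S -> T})
  (f : {rmorphism R -> S}) :
  Theta_hom (ring_comp g f) = digraph_comp (Theta_hom g) (Theta_hom f).
(* At [A] the right side is [Theta_map g] of the class of [f (repr A)], whose own chosen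
   representative may differ from [f (repr A)]. *)
Proof. by apply: digraph_hom_ext => A; apply/esym/Theta_map_cls. Qed.

Definition Theta_functor : functor_on FinRing Digraph Theta :=
  @FunctorOn FinRing Digraph Theta Theta_hom Theta_hom_id Theta_hom_comp.

(** As every vertex is some [cls x], the formula fixes the action of [F] on morphisms completely. *)
Theorem proposition2p7 :
  exists F : functor_on FinRing Digraph Theta,
    forall (R S : finPzRingType) (f : {rmorphism R -> S}) (x : R),
      (fmap F f : digraph_hom (Theta R) (Theta S)) (cls x) = cls (f x).
Proof. by exists Theta_functor => R S f x; apply: Theta_map_cls. Qed.
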